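(* Let $Z\subseteq\mathbb{P}^{n_1}\times\cdots\times\mathbb{P}^{n_k}$ be a set of fat points. Then \[(r_1,\ldots,r_k)+\mathbb{N}^k\subseteq\operatorname{reg}_B(Z),\] where $r_i=\operatorname{reg}(Z_i)$ for $i=1,\ldots,k$ and $Z_i=\pi_i(Z)\subseteq\mathbb{P}^{n_i}$.
   Context: Let $\mathbf{k}$ be an algebraically closed field of characteristic zero and let $n_1,\dots,n_k$ be positive integers. The homogeneous coordinate ring of $\mathbb{P}^{n_1}\times\cdots\times\mathbb{P}^{n_k}$ is $R=\mathbf{k}[x_{1,0},\ldots,x_{1,n_1},\ldots,x_{k,0},\ldots,x_{k,n_k}]$, graded by $\mathbb{N}^k$ with $\deg x_{i,j}=e_i$, the $i$th standard basis vector of $\mathbb{Z}^k$ ($\mathbb{N}$ contains $0$); its irrelevant ideal is $B=\bigcap_{i=1}^k\langle x_{i,j}\mid j=0,\ldots,n_i\rangle$. For a point $P$, $I_P\subseteq R$ is its defining prime ideal. Given distinct points $P_1,\dots,P_s$ ($s\ge1$) and positive integers $m_1,\dots,m_s$, the set (scheme) of fat points $Z=m_1P_1+\cdots+m_sP_s$ is defined by $I_Z=I_{P_1}^{m_1}\cap\cdots\cap I_{P_s}^{m_s}$. Let $\pi_i$ be the projection onto $\mathbb{P}^{n_i}$, let $R_i=\mathbf{k}[x_{i,0},\ldots,x_{i,n_i}]$, and let $I_{P_{ji}}\subseteq R_i$ be the ideal of the point $\pi_i(P_j)$. Then $Z_i=\pi_i(Z)$ is the scheme of fat points in $\mathbb{P}^{n_i}$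 defined by $I_{Z_i}=\bigcap_{j=1}^s I_{P_{ji}}^{m_j}\subseteq R_i$, and $\operatorname{reg}(Z_i)$ is the Castelnuovo-Mumford regularity of the graded ring $R_i/I_{Z_i}$. For $i\in\mathbb{Z}$, $\mathbb{N}^k[i]:=\bigcup(\operatorname{sign}(i)\underline{q}+\mathbb{N}^k)\subset\mathbb{Z}^k$, the union over all $\underline{q}\in\mathbb{N}^k$ whose coordinates sum to $|i|$ (so $\mathbb{N}^k[0]=\mathbb{N}^k$). For a finitely generated $\mathbb{N}^k$-graded $R$-module $M$ and $\underline{m}\in\mathbb{Z}^k$, $M$ is $\underline{m}$-regular if $H^i_B(M)_{\underline{p}}=0$ for all $i\ge0$ and all $\underline{p}\in\underline{m}+\mathbb{N}^k[1-i]$, where $H^i_B$ is local cohomology with support in $B$. $\operatorname{reg}_B(M)\subseteq\mathbb{Z}^k$ is the set of all $\underline{m}$ for which $M$ is $\underline{m}$-regular, and $\operatorname{reg}_B(Z):=\operatorname{reg}_B(R/I_Z)$. *)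

(* Defs.v *)
From HB Require Import structures.
From mathcomp Require Import all_boot all_order all_algebra.
From mathcomp Require Import boolp.
From mathcomp.multinomials Require Export mpoly.

Set Implicit Arguments.
Unset Strict Implicit.
Unset Printing Implicit Defensive.

Import GRing.Theory Num.Theory.
Local Open Scope ring_scope.

(* Ideals are submodules of the regular module R^o. The structure idealr of
   ring_quotient is not used because it excludes the unit ideal. *)
Section Ideals.
Variable R : comNzRingType.

Record ideal := Ideal {
  ideal_pred :> {pred R^o};
  ideal_closed : submod_closed ideal_pred }.

HB.instance Definition _ (I : ideal) :=
  GRing.isSubmodClosed.Build R R^o (ideal_pred I) (ideal_closed I).

Section QuotientModule.
Variable I : ideal.
Local Notation Q := {ideal_quot I}.

Definition quot_scale (a : R) (x : Q) : Q := (\pi_Q (a *: repr x))%qT.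

Lemma pi_quot_scale a v : quot_scale a (\pi_Q v)%qT = (\pi_Q (a *: v))%qT.
Proof.
apply/eqP; rewrite /quot_scale -Quotient.idealrBE -scalerBr; apply: rpredZ.
by rewrite Quotient.idealrBE reprK.
Qed.

Fact quot_scaleA a b x : quot_scale a (quot_scale b x) = quot_scale (a * b) x.
Proof. by rewrite -[x]reprK (pi_quot_scale b) !pi_quot_scale scalerA. Qed.

Fact quot_scale1 : left_id 1 quot_scale.
Proof. by move=> x; rewrite -[x]reprK pi_quot_scale scale1r. Qed.

Fact quot_scaleDr : right_distributive quot_scale +%R.
Proof.
move=> a x y; rewrite -[x]reprK -[y]reprK -raddfD !pi_quot_scale -raddfD.
by rewrite scalerDr.
Qed.

Fact quot_scaleDl x : {morph quot_scale^~ x : a b / a + b}.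
Proof. by move=> a b; rewrite -[x]reprK !pi_quot_scale -raddfD scalerDl. Qed.

HB.instance Definition _ := GRing.Zmodule_isLmodule.Build R Q
  quot_scaleA quot_scale1 quot_scaleDr quot_scaleDl.
End QuotientModule.

Definition gen_pred (S : R -> Prop) : {pred R^o} := fun x =>
  `[< exists n (a s : 'I_n -> R),
        (forall i, S (s i)) /\ x = \sum_(i < n) a i * s i >].

Fact gen_closed S : submod_closed (gen_pred S).
Proof.
split=> [|c x y].
  apply/asboolP; exists 0%N, (fun=> 0), (fun=> 0).
  by rewrite big_ord0; split=> // -[].
move=> /asboolP[n [a [s [Ss ->]]]] /asboolP[m [b [t [St ->]]]].
apply/asboolP; exists (n + m)%N.
exists (fun i => match split i with inl j => c * a j | inr j => b j end).
exists (fun i => match split i with inl j => s j | inr j => t j end).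
split=> [i|]; first by case: (split i).
rewrite big_split_ord /= scaler_sumr; congr (_ + _); apply: eq_bigr => i _.
  by rewrite (unsplitK (inl i)) /= -mulrA.
by rewrite (unsplitK (inr i)).
Qed.

Definition gen_ideal (S : R -> Prop) : ideal := Ideal (gen_closed S).

Definition pow_ideal (I : ideal) (m : nat) : ideal :=
  gen_ideal (fun g => exists s : 'I_m -> R,
    (forall i, s i \in I) /\ g = \prod_(i < m) s i).

Fact cap_closed (T : finType) (I : T -> ideal) :
  submod_closed ((fun x => [forall t, x \in I t]) : {pred R^o}).
Proof.
split=> [|c x y]; first by apply/forallP=> t; exact: (ideal_closed (I t)).1.
move=> /forallP xI /forallP yI; apply/forallP=> t.
exact: (ideal_closed (I t)).2.
Qed.

Definition cap_ideal (T : finType) (I : T -> ideal) : ideal :=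
  Ideal (cap_closed I).
End Ideals.

(* Local cohomology is computed by the Cech complex: for a finite family f of
   homogeneous generators of B,
     C^i(f; M) = \bigoplus_(s : {set 'I_r} | #|s| = i) M_(f_s),
   with f_s = \prod_(j in s) f j, and H^i_B(M) = H^i(C(f; M)). An element of
   C^i is encoded by an exponent n, common to all the (finitely many)
   components, and numerators a s: its component at s is a s / f_s ^+ n. *)
Section Cech.
Variables (D : zmodType) (R : comNzRingType) (M : lmodType R).
Variables (grR : D -> R -> Prop) (grM : D -> M -> Prop).

Section Family.
Variables (r : nat) (f : 'I_r -> R) (d : 'I_r -> D).
Implicit Types (s t : {set 'I_r}) (a b : {set 'I_r} -> M) (p : D).

Definition famprod s : R := \prod_(j in s) f j.

(* x / 1 = 0 in the localization of M at f_s *)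
Definition loc_zero s (x : M) := exists e, famprod s ^+ e *: x = 0.

(* the component at s of (n, a) has degree p *)
Definition cech_homog p n a s := grM (p + (\sum_(j in s) d j) *+ n) (a s).

(* the differential of (n, a) is (n, cech_diff n a): its component at t is
   \sum_(j in t) +/- a (t :\ j) / f_(t :\ j) ^+ n *)
Definition cech_diff n a t : M :=
  \sum_(j in t)
     (-1) ^+ #|[set l in t | (l < j)%N]| *: (f j ^+ n *: a (t :\ j)).

(* H^i(C(f; M))_p = 0; when i = 0 the differential cech_diff m b set0 is an
   empty sum, which accounts for C^(-1) = 0 *)
Definition cech_exact (i : nat) p :=
  forall n a,
    (forall s, #|s| = i -> cech_homog p n a s) ->
    (forall t, #|t| = i.+1 -> loc_zero t (cech_diff n a t)) ->
  exists m b,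
    (forall s, #|s|.+1 = i -> cech_homog p m b s) /\
    (forall s, #|s| = i ->
       loc_zero s (famprod s ^+ m *: a s - famprod s ^+ n *: cech_diff m b s)).
End Family.

(* H^i_B(M)_p = 0. Cech cohomology does not depend on the choice of the
   generators of B, so no particular choice is made. *)
Definition loc_coh_zero (B : ideal R) (i : nat) (p : D) :=
  forall r (f : 'I_r -> R) (d : 'I_r -> D),
    (forall j, grR (d j) (f j)) ->
    B =i gen_ideal (fun g => exists j, g = f j) ->
  cech_exact f d i p.
End Cech.

Notation degree k := {ffun 'I_k -> int}.

(* K[x_v, v : 'I_N] graded by Z^k, with deg x_v = e_(w v). *)
Section GradedPolynomials.
Variables (K : fieldType) (N k : nat) (w : 'I_N -> 'I_k).
Local Notation R := {mpoly K[N]}.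

Definition mon_degree (mu : 'X_{1..N}) : degree k :=
  [ffun l => (\sum_(v | w v == l) mu v)%N%:Z].

Definition homogeneous (p : degree k) (F : R) :=
  forall mu, mu \in msupp F -> mon_degree mu = p.

Definition var_ideal (l : 'I_k) : ideal R :=
  gen_ideal (fun g => exists2 v, w v = l & g = 'X_v).

Definition irrelevant_ideal : ideal R := cap_ideal var_ideal.

Lemma var_ideal_msupp l (F : R) mu :
  F \in var_ideal l -> mu \in msupp F -> exists2 v, w v = l & (0 < mu v)%N.
Proof.
move=> /asboolP[n [a [s [Ss ->]]]]; rewrite mcoeff_msupp raddf_sum /=.
case: (pselect (exists2 v, w v = l & (0 < mu v)%N)) => // no.
rewrite big1 ?eqxx // => i _; have [v wv ->] := Ss i.
apply: memN_msupp_eq0; apply/negP.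
rewrite (perm_mem (msuppMX _ _)) => /mapP[nu _ mu_eq].
by apply: no; exists v; rewrite // mu_eq mnmDE mnm1E eqxx.
Qed.

(* B is generated by the monomials \prod_l 'X_(c l), c a choice of one variable
   of each degree e_l; in particular it has a finite homogeneous generating
   family, as needed in loc_coh_zero. *)
Lemma irrelevant_ideal_gens :
  let T := {c : {ffun 'I_k -> 'I_N} | [forall l, w (c l) == l]} in
  let f (j : 'I_#|{: T}|) : R := \prod_l 'X_(val (enum_val j) l) in
  (forall j, homogeneous [ffun=> 1] (f j)) /\
  irrelevant_ideal =i gen_ideal (fun g => exists j, g = f j).
Proof.
move=> T f.
pose mc (c : T) : 'X_{1..N} := (\sum_l U_(val c l))%MM.
have wc (c : T) l : w (val c l) = l by case: c => c /= /forallP/(_ l)/eqP.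
have fE j : f j = 'X_[mc (enum_val j)].
  by rewrite /mc (big_morph _ (@mpolyXD _ _) (mpolyX0 _ _)).
have mcE (c : T) v : mc c v = (v == val c (w v)).
  rewrite mnm_sumE (bigD1 (w v)) //= mnm1E eq_sym big1 ?addn0 // => l lv.
  rewrite mnm1E; case: eqP => // vE; move: lv; by rewrite -vE wc eqxx.
split=> [j mu|F].
  rewrite fE msuppX inE => /eqP ->; apply/ffunP=> l; rewrite !ffunE.
  rewrite (bigD1 (val (enum_val j) l)) ?wc //= mcE wc eqxx big1 // => v /andP[/eqP <-].
  by rewrite mcE => /negPf ->.
apply/forallP/idP => [FB|].
  have ch mu : mu \in msupp F -> exists c : T, (mc c <= mu)%MM.
    move=> muF.
    have ex l : {v | w v = l & (0 < mu v)%N}.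
      by apply: cid2; apply: var_ideal_msupp (FB l) muF.
    have cP : [forall l, w ([ffun l => s2val (ex l)] l) == l].
      by apply/forallP=> l; rewrite ffunE; case: (ex l) => v /= ->.
    pose good (c : {ffun 'I_k -> 'I_N}) := is_true [forall l, w (c l) == l].
    exists (exist good _ cP); apply/mnm_lepP=> v; rewrite mcE /= ffunE.
    by case: (ex (w v)) => v' /= _; case: eqP => [->|].
  rewrite [F]mpolyE big_seq; apply: rpred_sum => /= mu /ch[c le_c].
  rewrite -(submK le_c) mpolyXD scalerAl; apply/asboolP; exists 1%N.
  exists (fun=> F@_(mu - mc c + mc c) *: 'X_[mu - mc c]), (fun=> 'X_[mc c]).
  split; last by rewrite big_ord1.
  by move=> _; exists (enum_rank c); rewrite fE enum_rankK.
move=> /asboolP[n [a [s [Ss ->]]]] l; apply: rpred_sum => i _.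
have [j ->] := Ss i; rewrite -[_ * _]/(a i *: (f j : R^o)); apply: rpredZ.
apply/asboolP; exists 1%N.
exists (fun=> \prod_(l' | l' != l) 'X_(val (enum_val j) l')).
exists (fun=> 'X_(val (enum_val j) l)); split.
  by move=> _; exists (val (enum_val j) l).
by rewrite big_ord1 /f (bigD1 l) //= mulrC.
Qed.

(* The defining ideal of a point with (multi)homogeneous coordinates x. *)
Definition point_ideal (x : 'I_N -> K) : ideal R :=
  gen_ideal (fun F => (exists p, homogeneous p F) /\ F.@[x] = 0).

Definition fat_ideal (s : nat) (x : 'I_s -> 'I_N -> K) (m : 'I_s -> nat) :
    ideal R :=
  cap_ideal (fun j => pow_ideal (point_ideal (x j)) (m j)).

Definition quot_gr (I : ideal R) (p : degree k) (y : {ideal_quot I}) :=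
  exists2 F : R, homogeneous p F & y = (\pi_{ideal_quot I} F)%qT.

(* p \in N^k[z], the union of the sgz z * q + N^k over q with |q| = |z| *)
Definition Nk_shift (z : int) (p : degree k) :=
  exists q u : 'I_k -> nat,
    (\sum_l q l = `|z|)%N /\ forall l, p l = sgz z * (q l)%:Z + (u l)%:Z.

Section Regularity.
Variables (M : lmodType R) (gr : degree k -> M -> Prop).

(* H^i_B(M)_p = 0 *)
Definition coh_zero (i : nat) (p : degree k) :=
  loc_coh_zero homogeneous gr irrelevant_ideal i p.

(* M is m-regular, i.e. m \in reg_B(M) *)
Definition regular (m : degree k) :=
  forall (i : nat) (p : degree k), Nk_shift (1 - i%:Z) (p - m) -> coh_zero i p.
End Regularity.
End GradedPolynomials.

(* r = reg(M) = max {d + i | H^i_m(M)_d != 0}, for the standard grading and the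
   ideal m generated by all the variables. *)
Definition std_grading {N : nat} (v : 'I_N) : 'I_1 := ord0.

Definition is_CM_reg (K : fieldType) (N : nat) (M : lmodType {mpoly K[N]})
    (gr : degree 1 -> M -> Prop) (r : int) :=
  let nonzero (i : nat) (d : int) := ~ coh_zero std_grading gr i [ffun=> d] in
  (exists i d, nonzero i d /\ d + i%:Z = r) /\
  (forall i d, nonzero i d -> d + i%:Z <= r).

Section MultiProjective.
Variables (K : fieldType) (k : nat) (n : 'I_k -> nat).

(* The variables x_(i, j), i < k, j <= n i, are numbered by enum_rank. *)
Definition multi_var := {i : 'I_k & 'I_(n i).+1}.
Definition num_vars := #|{: multi_var}|.
Definition block (v : 'I_num_vars) : 'I_k := tag (enum_val v).

(* Representatives of the points of P^(n 0) x ... x P^(n k-1) *)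
Definition multi_vec := forall i : 'I_k, 'rV[K]_(n i).+1.
Definition is_point (P : multi_vec) := forall i, P i != 0.
Definition same_point (P Q : multi_vec) :=
  forall i, exists2 c : K, c != 0 & P i = c *: Q i.

Definition coords (P : multi_vec) (v : 'I_num_vars) : K :=
  P (tag (enum_val v)) 0 (tagged (enum_val v)).

Variables (s : nat) (P : 'I_s -> multi_vec) (m : 'I_s -> nat).

(* I_Z, for Z = \sum_j m j * P j *)
Definition ideal_Z : ideal {mpoly K[num_vars]} :=
  fat_ideal block (fun j => coords (P j)) m.

(* I_(Z_i), for Z_i = pi_i(Z) *)
Definition ideal_proj (i : 'I_k) : ideal {mpoly K[(n i).+1]} :=
  fat_ideal std_grading (fun j => P j i 0) m.

(* t \in reg_B(Z) = reg_B(R / I_Z) *)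
Definition in_regB_Z (t : degree k) :=
  regular block (quot_gr block (I := ideal_Z)) t.

(* r = reg(Z_i) = reg(R_i / I_(Z_i)) *)
Definition is_reg_proj (i : 'I_k) (r : int) :=
  is_CM_reg (quot_gr std_grading (I := ideal_proj i)) r.
End MultiProjective.

(* Main.v *)
From HB Require Import structures.
From mathcomp Require Import all_boot all_order all_algebra.
From mathcomp Require Import boolp.
From mathcomp Require Import ring zify.
Require Import Defs.

(** Let M = R / I_Z, and let g be the product of linear forms l_i, one in each
    block of variables, that vanish at none of the points (such forms exist by
    exists_nonvanishing_form). The points then lie in an affine open set, and
    the Cech complex can be computed by hand.

    The element g is a nonzerodivisor on M, since the ideals I_P^m are primary
    (pow_point_ideal_primary): membership of F in I_P^m is an order of
    vanishing, which a form nonzero at P does not change. Moreover, if f is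
    homogeneous in B then inverting f on M inverts g (power_mod_prod_lin): a
    power of f is congruent to a multiple of g modulo I_Z. Hence the Cech
    complex of M agrees with that of M_g except in its first term, where M is
    replaced by M_g. As g lies in B, the complex of M_g is exact, by the
    contraction of cech_exact_of_regular. Thus H^i_B(M) = 0 for i <> 1, and
    H^1_B(M) = M_g / M. In other words H^1_B(M)_p = 0 if and only if, modulo
    I_Z, every form of degree p + e (1, ..., 1) is a multiple of g^e, for all e
    (divisible_in_degrees_above; fat_coh_zero and divisible_of_coh_zero).

    The same holds for each Z_i, so that for z >= r_i every form of R_i of
    degree z + e is congruent to l_i^e h modulo I_(Z_i) for some form h of
    degree z. If p_i >= r_i for all i, a monomial of degree p + e (1, ..., 1)
    is the product of its parts in the different blocks of variables, and
    I_(Z_i) is contained in I_Z: multiplying the k congruences shows that the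
    monomial is congruent to a multiple of g^e modulo I_Z
    (divisible_of_projections). So H^1_B(R / I_Z)_p = 0 for all p in r + N^k,
    and this is the regularity, the other cohomology groups being zero in every
    degree. *)

Set Implicit Arguments.
Unset Strict Implicit.
Unset Printing Implicit Defensive.

Import GRing.Theory Num.Theory.
Local Open Scope ring_scope.

(** * Contracting the Cech complex *)

Section CechContraction.
Variables (D : zmodType) (R : comNzRingType) (M : lmodType R).
Variables (grR : D -> R -> Prop) (grM : D -> M -> Prop).
Hypothesis grM0 : forall p, grM p 0.
Hypothesis grMD : forall p x y, grM p x -> grM p y -> grM p (x + y).
Hypothesis grMZ : forall q p c x,
  grR q c -> grM p x -> grM (q + p) (c *: x).
Hypothesis grRX : forall q c e, grR q c -> grR (q *+ e) (c ^+ e).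
Hypothesis grR_sign : forall e, grR 0 ((-1) ^+ e).

Variables (r : nat) (f : 'I_r -> R) (d : 'I_r -> D).
Hypothesis f_hom : forall j, grR (d j) (f j).
Implicit Types (s t : {set 'I_r}) (j l : 'I_r).

Local Notation sgn t j := ((-1) ^+ #|[set l in t | (l < j)%N]| : R).

Lemma sgn_sqr s j : sgn s j * sgn s j = 1.
Proof. by rewrite -expr2 sqrr_sign. Qed.

Lemma card_below_set1 l j : #|[set x in [set l] | (x < j)%N]| = (l < j)%N.
Proof.
case: (boolP (l < j)%N) => lj; last first.
  by apply: eq_card0 => x; rewrite !inE; case: eqP => // ->; apply: negbTE.
rewrite -[RHS]/1%N -(cards1 l); apply: eq_card => x.
by rewrite !inE; case: eqP => // ->.
Qed.

Lemma card_below_setU1 s l j : l \notin s ->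
  #|[set x in l |: s | (x < j)%N]| =
  ((l < j) + #|[set x in s | (x < j)%N]|)%N.
Proof.
move=> ls; rewrite (cardsD1 l) !inE eqxx /=; congr (_ + _)%N;
  apply: eq_card => x.
by rewrite !inE; case: eqP => // ->; rewrite (negPf ls).
Qed.

Lemma sgn_setU1 s l j : l \notin s ->
  sgn (l |: s) j = (-1) ^+ (l < j)%N * sgn s j.
Proof. by move=> ls; rewrite card_below_setU1 // exprD. Qed.

Lemma sgn_setD1 s l j : j \in s -> sgn s l = (-1) ^+ (j < l)%N * sgn (s :\ j) l.
Proof. by move=> js; rewrite -sgn_setU1 ?setD1K // !inE eqxx. Qed.

(** The relation that makes the terms indexed by j in s and l outside s cancel
    between the differential of the contraction and the contraction of the
    differential. *)
Lemma sgn_swap s j l : j \in s -> l \notin s ->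
  sgn s j * sgn (s :\ j) l = - (sgn s l * sgn (l |: s) j).
Proof.
move=> js ls; rewrite (sgn_setU1 _ ls) (sgn_setD1 l js).
have: j != l by apply: contraNneq ls => <-.
by rewrite -val_eqE /=; case: ltngtP => // _ _; rewrite /= ?expr0 ?expr1; ring.
Qed.

Lemma famprodU1 s l : l \notin s -> famprod f (l |: s) = f l * famprod f s.
Proof. by move=> ls; rewrite /famprod big_setU1. Qed.

(** There are finitely many t, and an exponent may always be increased. *)
Lemma loc_zero_uniform (i : nat) (a : {set 'I_r} -> M) :
  (forall t, #|t| = i -> loc_zero f t (a t)) ->
  exists e, forall t, #|t| = i -> famprod f t ^+ e *: a t = 0.
Proof.
move=> az; have /fin_all_exists[e he] t :
    exists e, #|t| = i -> famprod f t ^+ e *: a t = 0.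
  case: (pselect (#|t| = i)) => [/az[e]|nt]; last by exists 0%N.
  by exists e.
exists (\max_t e t) => t ti.
by rewrite -(subnK (leq_bigmax t)) exprD -scalerA he // scaler0.
Qed.

Section Contraction.
Variables (n e : nat) (c : 'I_r -> R) (a : {set 'I_r} -> M).

(** The homotopy attached to the partition of unity 1 = sum_l c_l f_l^(n + e) /
    g^E: when a has denominators f^n, the term c_l f_l^(n + e) / g^E * a_(s +
    l) has denominator g^E f_s^n, and the numerator that appears here. *)
Definition contraction s : M :=
  \sum_(l | l \notin s) (sgn s l * c l * f l ^+ e) *: a (l |: s).

(** The homotopy formula 1 = d h + h d, at the level of numerators and with the
    denominators cleared, so that sum_l c_l f_l^(n + e) replaces 1; the
    diagonal terms l = j of d h rebuild the part of the partition of unity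
    indexed by s. *)
Lemma contraction_homotopy s :
  (\sum_l c l * f l ^+ (n + e)) *: a s
    - \sum_(j in s) sgn s j *: (f j ^+ n *: contraction (s :\ j)) =
  \sum_(l | l \notin s)
    (sgn s l * c l * f l ^+ e) *: cech_diff f n a (l |: s).
Proof.
rewrite [in RHS](eq_bigr (fun l => (c l * f l ^+ (n + e)) *: a s
   + \sum_(j in s) (sgn s l * sgn (l |: s) j * (c l * f l ^+ e * f j ^+ n))
        *: a ((l |: s) :\ j))); last first.
  move=> l ls; rewrite /cech_diff big_setU1 //= scalerDr; congr (_ + _).
    rewrite !scalerA setU1K // sgn_setU1 // ltnn expr0 mul1r exprD.
    by congr (_ *: _); rewrite -[RHS]mul1r -[X in _ = X * _](sgn_sqr s l); ring.
  rewrite scaler_sumr; apply: eq_bigr => j js; rewrite !scalerA.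
  by congr (_ *: _); ring.
rewrite [in LHS](eq_bigr (fun j => (c j * f j ^+ (n + e)) *: a s
   + \sum_(l | l \notin s)
        (sgn s j * sgn (s :\ j) l * (c l * f l ^+ e * f j ^+ n))
        *: a ((l |: s) :\ j))); last first.
  move=> j js; rewrite /contraction (bigD1 j) ?in_setD1 ?eqxx //= !scalerDr.
  congr (_ + _).
    rewrite !scalerA setD1K // (sgn_setD1 j js) ltnn expr0 mul1r exprD.
    congr (_ *: _).
    by rewrite -[RHS]mul1r -[X in _ = X * _](sgn_sqr (s :\ j) j); ring.
  rewrite !scaler_sumr; apply: eq_big => [l|l].
    rewrite in_setD1; case: (eqVneq l j) => [->|] /=; first by rewrite js.
    by rewrite andbT.
  move=> /andP[_ lj]; rewrite !scalerA.
  congr (_ *: a _); first by ring.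
  apply/setP=> x; rewrite !inE.
  by case: (eqVneq x l) => [->|] //=; rewrite lj.
rewrite !big_split /= (bigID (mem s)) /= scalerDl !scaler_suml.
rewrite opprD addrACA subrr add0r; congr (_ + _).
rewrite exchange_big /= -sumrN; apply: eq_bigr => l ls.
rewrite -sumrN; apply: eq_bigr => j js.
by rewrite sgn_swap // !mulNr scaleNr opprK.
Qed.
End Contraction.

Section Exactness.
Variables (g : R) (delta : D) (i : nat) (p : D).
Hypothesis g_regular : forall x : M, g *: x = 0 -> x = 0.
(** That is, g lies in the radical of the ideal of the f_l, so that the f_l
    generate the unit ideal after inverting g. *)
Hypothesis g_in_powers : forall N, exists E (c : 'I_r -> R),
  g ^+ E = \sum_l c l * f l ^+ N /\
  forall l, grR (delta *+ E - d l *+ N) (c l).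
(** For s nonempty, this says that inverting f_s on M inverts g. It concerns
    the empty s only when i = 1, and then requires M_(p + E delta) to be g^E
    M_p. The exponent e is shared by all s since the components of a cochain
    share their denominator exponent. *)
Hypothesis g_divides : forall E, exists e, forall s, #|s|.+1 = i ->
  forall n y, grM (p + (\sum_(j in s) d j) *+ n + delta *+ E) y ->
  exists y', grM (p + (\sum_(j in s) d j) *+ (n + e)) y' /\
    g ^+ E *: y' = famprod f s ^+ e *: y.

Lemma regularX E (x : M) : g ^+ E *: x = 0 -> x = 0.
Proof.
elim: E => [|E IH]; first by rewrite expr0 scale1r.
by rewrite exprS -scalerA => /g_regular.
Qed.

(** Over M_g, the contraction makes every cocycle a coboundary. The cochain so
    obtained has g^E in its denominators; g_divides removes it, and since g is
    a nonzerodivisor the resulting identity holds over M. *)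
Theorem cech_exact_of_regular : cech_exact grM f d i p.
Proof.
move=> n a a_hom /loc_zero_uniform[e a_cocycle].
have [E [c [gE c_hom]]] := g_in_powers (n + e).
have [e' div] := g_divides E.
pose y := contraction e c a.
have y_hom s : #|s|.+1 = i ->
    grM (p + (\sum_(j in s) d j) *+ n + delta *+ E) (y s).
  move=> si; apply: (big_ind (grM _)) => // [x x'|l ls]; first exact: grMD.
  have /a_hom : #|l |: s| = i by rewrite cardsU1 ls.
  have := grMZ (grRX e (f_hom l)); rewrite /cech_homog big_setU1 //=.
  move=> fe /fe ael; have := grMZ (c_hom l) ael.
  move=> /(grMZ (grR_sign #|[set l0 in s | (l0 < l)%N]|)); rewrite !scalerA.
  congr grM; rewrite mulrnDl mulrnDr add0r.
  move: (delta *+ E) (_ *+ n) (d l *+ n) (d l *+ e) => A B C C'.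
  by rewrite [p + (C + B)]addrCA [C' + _]addrA [C' + C]addrC [LHS]addrA subrK
    addrC.
have /fin_all_exists[b bP] s : exists b, #|s|.+1 = i ->
    grM (p + (\sum_(j in s) d j) *+ (n + e')) b /\
    g ^+ E *: b = famprod f s ^+ e' *: y s.
  case: (pselect (#|s|.+1 = i)) => [si|nsi]; last by exists 0.
  by have [b bP] := div s si n (y s) (y_hom s si); exists b.
exists (n + e')%N, b; split=> [s si|s si]; first by have [] := bP s si.
exists e; apply: (@regularX E).
(* As g^E b_t = f_t^e' y_t, multiplying by g^E replaces b by the contraction,
   at the cost of the factor f_s^e'. *)
have diffE : g ^+ E *: cech_diff f (n + e') b s =
    famprod f s ^+ e' *: \sum_(j in s) sgn s j *: (f j ^+ n *: y (s :\ j)).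
  rewrite /cech_diff !scaler_sumr; apply: eq_bigr => j js.
  have sj : #|s :\ j|.+1 = i by rewrite -si (cardsD1 j s) js.
  have [_ gb] := bP _ sj.
  have fE : famprod f s = f j * famprod f (s :\ j).
    by rewrite /famprod (big_setD1 j).
  transitivity ((sgn s j * f j ^+ (n + e')) *: (g ^+ E *: b (s :\ j))).
    by rewrite !scalerA; congr (_ *: _); ring.
  by rewrite gb !scalerA; congr (_ *: _); rewrite fE exprMn exprD; ring.
transitivity (famprod f s ^+ (n + e') *: (famprod f s ^+ e *:
    (g ^+ E *: a s - \sum_(j in s) sgn s j *: (f j ^+ n *: y (s :\ j))))).
  rewrite !scalerBr !scalerA; congr (_ - _).
    by congr (_ *: _); ring.
  transitivity ((famprod f s ^+ e * famprod f s ^+ n) *: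
      (g ^+ E *: cech_diff f (n + e') b s)).
    by rewrite !scalerA; congr (_ *: _); ring.
  by rewrite diffE scalerA exprD; congr (_ *: _); ring.
rewrite gE contraction_homotopy scaler_sumr big1 ?scaler0 // => l ls.
have ti : #|l |: s| = i.+1 by rewrite cardsU1 ls si.
rewrite scalerA.
transitivity ((sgn s l * c l) *: (famprod f (l |: s) ^+ e *:
    cech_diff f n a (l |: s))); last by rewrite a_cocycle // scaler0.
by rewrite scalerA famprodU1 // exprMn; congr (_ *: _); ring.
Qed.
End Exactness.
End CechContraction.

(** * Ideals, their powers and their quotients *)

Section IdealTheory.
Variable R : comNzRingType.
Implicit Types (I J : ideal R) (x y c : R).

Lemma idealM I c x : x \in I -> c * x \in I.
Proof. by move=> xI; rewrite -[c * x]/(c *: (x : R^o)); apply: rpredZ. Qed.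

Lemma gen_ideal_mem (S : R -> Prop) x : S x -> x \in gen_ideal S.
Proof.
move=> Sx; apply/asboolP; exists 1%N, (fun=> 1), (fun=> x).
by rewrite big_ord1 mul1r.
Qed.

Lemma gen_ideal_min (S : R -> Prop) I :
  (forall x, S x -> x \in I) -> forall x, x \in gen_ideal S -> x \in I.
Proof.
move=> SI _ /asboolP[n [a [t [St ->]]]].
by apply: rpred_sum => i _; apply/idealM/SI.
Qed.

Lemma gen_family_coef r (f : 'I_r -> R) x :
  x \in gen_ideal (fun y => exists j, y = f j) ->
  exists c : 'I_r -> R, x = \sum_l c l * f l.
Proof.
move=> /asboolP[n [a [t [/fin_all_exists[h hP] ->]]]].
exists (fun l => \sum_(i | h i == l) a i).
rewrite (partition_big h predT) //=; apply: eq_bigr => l _.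
by rewrite mulr_suml; apply: eq_bigr => i /eqP <-; rewrite hP.
Qed.

Lemma pow_ideal_prod I m (t : 'I_m -> R) :
  (forall i, t i \in I) -> \prod_(i < m) t i \in pow_ideal I m.
Proof. by move=> tI; apply: gen_ideal_mem; exists t. Qed.

Lemma pow_ideal_expr I m x : x \in I -> x ^+ m \in pow_ideal I m.
Proof.
move=> xI; rewrite -[m in _ ^+ m]card_ord -prodr_const.
exact: pow_ideal_prod.
Qed.

Lemma pow_ideal0 I x : x \in pow_ideal I 0.
Proof.
by rewrite -[x]mulr1; apply/idealM; rewrite -(expr0 0);
  apply/pow_ideal_expr/rpred0.
Qed.

Lemma pow_idealM I a b x y :
  x \in pow_ideal I a -> y \in pow_ideal I b -> x * y \in pow_ideal I (a + b).
Proof.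
move=> /asboolP[n [u [t [tI ->]]]] /asboolP[n' [u' [t' [t'I ->]]]].
rewrite mulr_suml; apply: rpred_sum => i _.
rewrite mulr_sumr; apply: rpred_sum => j _.
have [v [vI ->]] := tI i; have [v' [v'I ->]] := t'I j.
rewrite mulrACA; apply: idealM; apply: gen_ideal_mem.
exists (fun k => match split k with inl k => v k | inr k => v' k end).
split=> [k|]; first by case: (split k).
rewrite big_split_ord; congr (_ * _); apply: eq_bigr => k _ /=.
  by rewrite (unsplitK (inl k)).
by rewrite (unsplitK (inr k)).
Qed.

Lemma pow_ideal_anti I a b x : (a <= b)%N ->
  x \in pow_ideal I b -> x \in pow_ideal I a.
Proof.
move=> /subnKC <-; apply: gen_ideal_min => _ [t [tI ->]].
rewrite big_split_ord [X in X \in _]mulrC.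
by apply: idealM; apply: pow_ideal_prod.
Qed.

Lemma cap_idealP (T : finType) (I : T -> ideal R) x :
  reflect (forall t, x \in I t) (x \in cap_ideal I).
Proof. exact: forallP. Qed.

Lemma cap_pow_ideal_prod (T : finType) (I : T -> ideal R) (m : T -> nat)
    (x : T -> R) :
  (forall t, x t \in I t) ->
  \prod_t x t ^+ m t \in cap_ideal (fun t => pow_ideal (I t) (m t)).
Proof.
move=> xI; apply/cap_idealP => t; rewrite (bigD1 t) // [X in X \in _]mulrC.
by apply: idealM; apply: pow_ideal_expr.
Qed.

Lemma congr_ideal_mul I x x' y y' :
  x - x' \in I -> y - y' \in I -> x * y - x' * y' \in I.
Proof.
move=> xI yI; rewrite (_ : _ - _ = y * (x - x') + x' * (y - y')); last by ring.
by apply: rpredD; apply: idealM.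
Qed.

Lemma congr_ideal_prod (T : finType) I (x y : T -> R) :
  (forall t, x t - y t \in I) -> \prod_t x t - \prod_t y t \in I.
Proof.
move=> xy; apply: (big_ind2 (fun a b => a - b \in I)) => //.
  by rewrite subrr rpred0.
by move=> *; apply: congr_ideal_mul.
Qed.

Lemma congr_ideal_exp I e x y : x - y \in I -> x ^+ e - y ^+ e \in I.
Proof. by move=> xy; rewrite subrXX mulrC; apply: idealM. Qed.

Lemma pi_ideal_eq0 I x : (\pi_{ideal_quot I} x = 0)%qT <-> x \in I.
Proof.
rewrite -(raddf0 (\pi_{ideal_quot I}))%qT; split.
  by move/eqP; rewrite -Quotient.idealrBE subr0.
by move=> xI; apply/eqP; rewrite -Quotient.idealrBE subr0.
Qed.

Lemma scale_pi_ideal I c x :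
  c *: (\pi_{ideal_quot I} x)%qT = (\pi_{ideal_quot I} (c * x))%qT.
Proof. exact: pi_quot_scale. Qed.

(** In the binomial expansion of (y + z)^(a + b), each term is a multiple of
    y^a or of z^b. *)
Lemma radical_sum I (T : finType) (c x : T -> R) N :
  (forall t, x t ^+ N \in I) -> exists E, (\sum_t c t * x t) ^+ E \in I.
Proof.
move=> xI; apply: (big_ind (fun y => exists E, y ^+ E \in I)).
- by exists 1%N; rewrite expr1 rpred0.
- move=> y z [a ya] [b zb]; exists (a + b)%N.
  rewrite exprDn; apply: rpred_sum => i _; apply: rpredMn.
  case: (leqP b i) => bi.
    by rewrite -(subnK bi) exprD mulrA; apply: idealM.
  have le_a : (a <= a + b - i)%N by rewrite -addnBA ?leq_addr // ltnW.
  by rewrite -(subnK le_a) exprD mulrC mulrA; apply: idealM.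
- by move=> t _; exists N; rewrite exprMn; apply: idealM.
Qed.
End IdealTheory.

Lemma pow_ideal_rmorph (R S : comNzRingType) (phi : {rmorphism R -> S})
    (I : ideal R) (J : ideal S) m :
  (forall x, x \in I -> phi x \in J) ->
  forall x, x \in pow_ideal I m -> phi x \in pow_ideal J m.
Proof.
move=> IJ _ /asboolP[n [a [t [tI ->]]]].
rewrite rmorph_sum; apply: rpred_sum => i _; rewrite rmorphM; apply: idealM.
have [v [vI ->]] := tI i; rewrite rmorph_prod.
by apply: pow_ideal_prod => k; apply: IJ.
Qed.

(** * Multigraded polynomials *)

Definition unit_degree k (i : 'I_k) : degree k := [ffun l => (l == i)%:Z].
Definition ones k : degree k := [ffun=> 1].

Lemma sum_unit_degree k (c : 'I_k -> nat) l :
  (\sum_i unit_degree i *+ c i) l = (c l)%:Z.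
Proof.
rewrite sum_ffunE (bigD1 l) //= ffunMnE ffunE eqxx big1 ?addr0.
  exact: natz.
by move=> i /negPf il; rewrite ffunMnE ffunE eq_sym il mul0rn.
Qed.

Section Graded.
Variables (K : fieldType) (N k : nat) (w : 'I_N -> 'I_k).
Local Notation R := {mpoly K[N]}.
Implicit Types (p q : degree k) (F G : R).

Lemma mon_degreeD mu nu :
  mon_degree w (mu + nu)%MM = mon_degree w mu + mon_degree w nu.
Proof.
apply/ffunP=> l; rewrite !ffunE -PoszD -big_split /=; congr Posz.
by apply: eq_bigr => v _; rewrite mnmDE.
Qed.

Lemma mon_degree0 : mon_degree w 0%MM = 0.
Proof. by apply/ffunP=> l; rewrite !ffunE big1 // => v _; rewrite mnm0E. Qed.

Lemma mon_degreeU v : mon_degree w U_(v)%MM = unit_degree (w v).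
Proof.
apply/ffunP=> l; rewrite !ffunE; congr Posz; case: eqP => [->|/eqP wl].
  rewrite (bigD1 v) //= mnm1E eqxx big1 // => v' /andP[_ /negPf vv'].
  by rewrite mnm1E eq_sym vv'.
rewrite big1 // => v' /eqP wv'; rewrite mnm1E; case: eqP => // vv'.
by move: wl; rewrite vv' wv' eqxx.
Qed.

Lemma homogeneousE p F :
  homogeneous w p F <-> forall mu, mon_degree w mu != p -> F@_mu = 0.
Proof.
split=> [Fp mu|Fp mu].
  by move/eqP => mup; apply: memN_msupp_eq0; apply/negP => /Fp.
by rewrite mcoeff_msupp; apply: contra_neq_eq => /Fp.
Qed.

Lemma homogeneous0 p : homogeneous w p (0 : R).
Proof. by move=> mu; rewrite msupp0. Qed.

Lemma homogeneousD p F G :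
  homogeneous w p F -> homogeneous w p G -> homogeneous w p (F + G).
Proof. by move=> Fp Gp mu /msuppD_le; rewrite mem_cat => /orP[/Fp|/Gp]. Qed.

Lemma homogeneousM p q F G :
  homogeneous w p F -> homogeneous w q G -> homogeneous w (p + q) (F * G).
Proof.
move=> Fp Gq mu /msuppM_le/allpairsP[[a b] /= [/Fp <- /Gq <- ->]].
exact: mon_degreeD.
Qed.

Lemma homogeneousC c : homogeneous w 0 (c%:MP : R).
Proof.
move=> mu; rewrite msuppC; case: ifP => // _.
by rewrite inE => /eqP->; apply: mon_degree0.
Qed.

Lemma homogeneousZ p c F : homogeneous w p F -> homogeneous w p (c *: F).
Proof.
by move=> Fp; rewrite -mul_mpolyC -[p]add0r; apply: homogeneousM => //;
  apply: homogeneousC.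
Qed.

Lemma homogeneousB p F G :
  homogeneous w p F -> homogeneous w p G -> homogeneous w p (F - G).
Proof.
move=> Fp Gp; apply: homogeneousD => //.
by rewrite -scaleN1r; apply: homogeneousZ.
Qed.

Lemma homogeneous_sum (T : Type) (r : seq T) (P : pred T) p (F : T -> R) :
  (forall t, P t -> homogeneous w p (F t)) ->
  homogeneous w p (\sum_(t <- r | P t) F t).
Proof.
by move=> Fp; apply: big_ind => //; [apply: homogeneous0|apply: homogeneousD].
Qed.

Lemma homogeneousX mu : homogeneous w (mon_degree w mu) ('X_[mu] : R).
Proof. by move=> nu; rewrite msuppX inE => /eqP ->. Qed.

Lemma homogeneousU v : homogeneous w (unit_degree (w v)) ('X_v : R).
Proof. by rewrite -mon_degreeU; apply: homogeneousX. Qed.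

Lemma homogeneous_prod (T : Type) (r : seq T) (P : pred T)
    (d : T -> degree k) (F : T -> R) :
  (forall t, P t -> homogeneous w (d t) (F t)) ->
  homogeneous w (\sum_(t <- r | P t) d t) (\prod_(t <- r | P t) F t).
Proof.
move=> Fd; apply: (big_ind2 (homogeneous w)) => //.
  by rewrite -mpolyC1; apply: homogeneousC.
by move=> *; apply: homogeneousM.
Qed.

Lemma homogeneous_exp p F e :
  homogeneous w p F -> homogeneous w (p *+ e) (F ^+ e).
Proof.
move=> Fp; rewrite -[e]card_ord -prodr_const -sumr_const.
exact: homogeneous_prod.
Qed.

Definition hom_part p F : R :=
  \sum_(mu <- msupp F | mon_degree w mu == p) F@_mu *: 'X_[mu].

Lemma mcoeff_hom_part p F mu :
  (hom_part p F)@_mu = if mon_degree w mu == p then F@_mu else 0.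
Proof.
rewrite raddf_sum /=; have [muF|muF] := boolP (mu \in msupp F); last first.
  rewrite (memN_msupp_eq0 muF) if_same big_seq_cond big1 // => nu /andP[nuF _].
  by rewrite mcoeffZ mcoeffX; case: eqP muF nuF => [->/negP|]; rewrite ?mulr0.
rewrite big_mkcond (bigD1_seq mu) ?msupp_uniq //= big1 ?addr0.
  by case: ifP => // _; rewrite mcoeffZ mcoeffX eqxx mulr1.
move=> nu /negPf numu; case: ifP => // _.
by rewrite mcoeffZ mcoeffX numu mulr0.
Qed.

Lemma hom_part_homogeneous p F : homogeneous w p (hom_part p F).
Proof. by apply/homogeneousE => mu /negPf mup; rewrite mcoeff_hom_part mup. Qed.

Lemma hom_part_id p F : homogeneous w p F -> hom_part p F = F.
Proof.
move=> /homogeneousE Fp; apply/mpolyP => mu; rewrite mcoeff_hom_part.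
by case: eqP => // /eqP /Fp ->.
Qed.

Lemma hom_partD p : {morph hom_part p : F G / F + G}.
Proof.
move=> F G; apply/mpolyP => mu; rewrite mcoeffD !mcoeff_hom_part mcoeffD.
by case: ifP; rewrite ?addr0.
Qed.

Lemma hom_part0 p : hom_part p 0 = 0.
Proof. by rewrite /hom_part msupp0 big_nil. Qed.

Lemma hom_partM p q F G : homogeneous w q G ->
  hom_part (p + q) (F * G) = hom_part p F * G.
Proof.
move=> Gq; rewrite -{1}[F](subrK (hom_part p F)) mulrDl hom_partD.
rewrite [X in _ + X]hom_part_id; last first.
  by apply: homogeneousM => //; apply: hom_part_homogeneous.
rewrite [X in X + _](_ : _ = 0) ?add0r //; apply/mpolyP => mu.
rewrite mcoeff0 mcoeff_hom_part; case: eqP => // mupq.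
apply: memN_msupp_eq0; apply/negP => /msuppM_le/allpairsP[[a b] /= [aF /Gq bq]].
move=> muE; move: mupq aF; rewrite muE mon_degreeD bq => /addIr ap.
by rewrite mcoeff_msupp mcoeffB mcoeff_hom_part ap eqxx subrr eqxx.
Qed.

(** The coefficients can be replaced by their homogeneous components of the
    complementary degrees. *)
Lemma homogeneous_combination p r (f c : 'I_r -> R) (d : 'I_r -> degree k) F :
    (forall j, homogeneous w (d j) (f j)) -> homogeneous w p F ->
    F = \sum_l c l * f l ->
  exists c' : 'I_r -> R, F = \sum_l c' l * f l /\
    forall l, homogeneous w (p - d l) (c' l).
Proof.
move=> fd Fp FE; exists (fun l => hom_part (p - d l) (c l)).
split=> [|l]; last exact: hom_part_homogeneous.
rewrite -(hom_part_id Fp) FE (big_morph _ (hom_partD p) (hom_part0 p)).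
by apply: eq_bigr => l _; rewrite -[in LHS](subrK (d l) p) hom_partM.
Qed.

Lemma homogeneous_var_ideal p F l :
  homogeneous w p F -> p l != 0 -> F \in var_ideal K w l.
Proof.
move=> Fp pl; rewrite [F]mpolyE big_seq; apply: rpred_sum => mu /Fp mup.
have [v /eqP wv mv] : exists2 v, w v == l & mu v != 0%N.
  apply/exists_inP; apply: contraNT pl;
    rewrite negb_exists_in -mup => /forall_inP mu0.
  by rewrite ffunE big1 // => v /mu0/negPn/eqP.
have mvE : (U_(v) <= mu)%MM.
  apply/mnm_lepP => v'; rewrite mnm1E; case: eqP => // <-; by rewrite lt0n.
rewrite -(submK mvE) mpolyXD scalerAl; apply: idealM; apply: gen_ideal_mem.
by exists v.
Qed.
End Graded.

(** * Powers of the ideal of a point *)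

Lemma coef_lt_mul (A : nzRingType) (n m : nat) (P Q : {poly A}) :
  (forall j, (j < n)%N -> P`_j = 0) -> (forall j, (j < m)%N -> Q`_j = 0) ->
  forall j, (j < n + m)%N -> (P * Q)`_j = 0.
Proof.
move=> Pn Qm j jnm; rewrite coefM big1 // => i _.
case: (ltnP i n) => [/Pn->|ni]; first by rewrite mul0r.
rewrite Qm ?mulr0 // ltn_subLR; last by rewrite -ltnS.
by rewrite (leq_trans jnm) // leq_add2r.
Qed.

Lemma coef_lt_cancel (A : idomainType) (m : nat) (P Q : {poly A}) : P`_0 != 0 ->
  (forall j, (j < m)%N -> (P * Q)`_j = 0) -> forall j, (j < m)%N -> Q`_j = 0.
Proof.
move=> P0 PQ j; elim/ltn_ind: j => j IH jm; apply/eqP.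
have /eqP := PQ j jm; rewrite coefM big_ord_recl /= subn0 big1 ?addr0.
  by rewrite mulf_eq0 (negPf P0).
move=> i _; have ij : (j - bump 0 i < j)%N.
  by rewrite ltn_subrL (leq_ltn_trans _ (ltn_ord i)).
by rewrite IH ?mulr0 // (ltn_trans ij).
Qed.

Section PointIdealPowers.
Variables (K : fieldType) (N k : nat) (w : 'I_N -> 'I_k) (z : 'I_N -> K).
Local Notation R := {mpoly K[N]}.
Variable lin : 'I_k -> R.
Hypothesis lin_hom : forall i, homogeneous w (unit_degree i) (lin i).
Hypothesis lin_z : forall i, (lin i).@[z] != 0.

Local Notation I := (point_ideal w z).

(** Normalized to take the value 1 at z. *)
Definition unit_lin i : R := (lin i).@[z]^-1 *: lin i.

Lemma unit_lin_hom i : homogeneous w (unit_degree i) (unit_lin i).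
Proof. exact: homogeneousZ. Qed.

Lemma sub_lin_point_ideal v : 'X_v - z v *: unit_lin (w v) \in I.
Proof.
apply: gen_ideal_mem; split.
  exists (unit_degree (w v)); apply: homogeneousB; first exact: homogeneousU.
  by apply: homogeneousZ; apply: unit_lin_hom.
by rewrite mevalB !mevalZ mevalXU mulVf ?mulr1 ?subrr.
Qed.

(** With x = z lam + (x - z lam), where z lam is a point of the cone over z,
    the second summand is scaled by the parameter 'X. The value 'X = 0
    restricts F to the cone over z and 'X = 1 gives back F; the order in 'X is
    the order of vanishing of F along the cone. *)
Definition dilation : R -> {poly R} :=
  mmap (polyC \o @mpolyC N K)
    (fun v => (z v *: unit_lin (w v))%:P
              + 'X * ('X_v - z v *: unit_lin (w v))%:P).

HB.instance Definition _ := GRing.RMorphism.copy dilation dilation.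

Lemma dilation_horner a F : (dilation F).[a] =
  \sum_(mu <- msupp F) F@_mu *: \prod_v
    (z v *: unit_lin (w v) + a * ('X_v - z v *: unit_lin (w v))) ^+ mu v.
Proof.
rewrite /dilation /mmap horner_sum; apply: eq_bigr => mu _.
rewrite hornerM hornerC -mul_mpolyC /mmap1 horner_prod; congr (_ * _).
by apply: eq_bigr => v _; rewrite horner_exp !hornerE.
Qed.

Lemma dilation_at1 F : (dilation F).[1] = F.
Proof.
rewrite dilation_horner [RHS]mpolyE; apply: eq_bigr => mu _; congr (_ *: _).
by rewrite mpolyXE_id; apply: eq_bigr => v _; rewrite mul1r addrC subrK.
Qed.

(** On the cone over z, a form is determined by its value at z. *)
Lemma dilation_coef0 p F : homogeneous w p F ->
  (dilation F)`_0 = F.@[z] *: \prod_i unit_lin i ^+ `|p i|%N.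
Proof.
move=> Fp; rewrite -horner_coef0 dilation_horner mevalE scaler_suml.
rewrite big_seq [RHS]big_seq; apply: eq_bigr => mu /Fp <-.
rewrite -scalerA; congr (_ *: _).
under eq_bigr do rewrite mul0r addr0 exprZn.
rewrite scaler_prod; congr (_ *: _).
rewrite (partition_big w predT) //=; apply: eq_bigr => i _.
by rewrite ffunE /= expr_sum; apply: eq_bigr => v /eqP ->.
Qed.

(** The Rees algebra of I, the sum of the I^j 'X^j. *)
Definition rees (Q : {poly R}) := forall j, Q`_j \in pow_ideal I j.

Lemma reesM P Q : rees P -> rees Q -> rees (P * Q).
Proof.
move=> HP HQ j; rewrite coefM; apply: rpred_sum => i _.
by rewrite -[j in pow_ideal _ j](@subnKC i j) -1?ltnS // pow_idealM.
Qed.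

Lemma reesC c : rees c%:P.
Proof.
move=> [|j]; first exact: pow_ideal0.
by rewrite coefC; apply: rpred0.
Qed.

Lemma reesXC y : y \in I -> rees ('X * y%:P).
Proof.
move=> yI [|[|j]]; first exact: pow_ideal0.
  have -> : ('X * y%:P)`_1 = y ^+ 1 by rewrite coefXM coefC.
  exact: pow_ideal_expr.
by rewrite coefXM coefC; apply: rpred0.
Qed.

Lemma reesD P Q : rees P -> rees Q -> rees (P + Q).
Proof. by move=> HP HQ j; rewrite coefD rpredD. Qed.

(** The images of the variables belong to the Rees algebra. *)
Lemma rees_dilation F : rees (dilation F).
Proof.
rewrite /dilation /mmap; apply: big_ind; first exact: reesC.
  exact: reesD.
move=> mu _; apply: reesM; first exact: reesC.
rewrite /mmap1; apply: big_ind; [exact: reesC|exact: reesM|move=> v _].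
elim: (mu v) => [|e IH]; first exact: reesC.
rewrite exprS; apply: reesM => //; apply: reesD; first exact: reesC.
exact/reesXC/sub_lin_point_ideal.
Qed.

(** The m-th power of the ideal consists of the polynomials that vanish to
    order m along the cone. A generator of the ideal has no constant
    coefficient by dilation_coef0; conversely F is the sum of the coefficients
    of its dilation, and by rees_dilation the one of 'X^j lies in I^j. *)
Lemma pow_point_idealP m F :
  F \in pow_ideal I m <-> forall j, (j < m)%N -> (dilation F)`_j = 0.
Proof.
split=> [|F0].
  have I0 y : y \in I -> (dilation y)`_0 = 0.
    move=> /asboolP[n [a [t [St ->]]]].
    rewrite rmorph_sum coef_sum big1 // => i _; have [[p tp] tz] := St i.
    by rewrite rmorphM coef0M [X in _ * X](dilation_coef0 tp) tz scale0r mulr0.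
  move=> /asboolP[n [a [t [St ->]]]] j jm.
  rewrite rmorph_sum coef_sum big1 // => i _; have [u [uI ->]] := St i.
  rewrite rmorphM rmorph_prod.
  apply: (@coef_lt_mul _ 0 m) => // {jm}j.
  elim: m u uI j {t St} => [|m IH] u uI j jm; first by [].
  rewrite big_ord_recl; apply: (@coef_lt_mul _ 1 m) => //= => [[]|] //.
    by move=> _; apply: I0.
  by move=> l lm; apply: IH.
rewrite -(dilation_at1 F) horner_coef; apply: rpred_sum => j _.
rewrite mulrC; apply: idealM; case: (ltnP j m) => [/F0 ->|mj].
  exact: rpred0.
by apply: (pow_ideal_anti mj); apply: rees_dilation.
Qed.

Lemma unit_lin_neq0 i : unit_lin i != 0.
Proof.
apply/eqP => /(congr1 (meval z)) /eqP; rewrite mevalZ meval0 mulVf //.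
by rewrite oner_eq0.
Qed.

(** A form that does not vanish at z has a dilation with nonzero constant
    coefficient; multiplying by it does not change the order in 'X, because the
    coefficients lie in a domain. *)
Theorem pow_point_ideal_primary p G m F : homogeneous w p G -> G.@[z] != 0 ->
  G * F \in pow_ideal I m -> F \in pow_ideal I m.
Proof.
move=> Gp Gz /pow_point_idealP GF; apply/pow_point_idealP.
apply: (@coef_lt_cancel _ m (dilation G)); last by rewrite -rmorphM.
rewrite (dilation_coef0 Gp) scaler_eq0 negb_or Gz /=.
by apply/prodf_neq0 => i _; rewrite expf_neq0 // unit_lin_neq0.
Qed.
End PointIdealPowers.

(** * Cohomology of fat points *)

Section FatPoints.
Variables (K : fieldType) (N k : nat) (w : 'I_N -> 'I_k).
Variables (s : nat) (x : 'I_s -> 'I_N -> K) (m : 'I_s -> nat).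
Local Notation R := {mpoly K[N]}.
Variable lin : 'I_k -> R.
Hypothesis lin_hom : forall i, homogeneous w (unit_degree i) (lin i).
Hypothesis lin_x : forall i j, (lin i).@[x j] != 0.

Local Notation I := (fat_ideal w x m).
Local Notation M := {ideal_quot I}.
Local Notation g := (\prod_i lin i).
Local Notation total := (\sum_j m j)%N.

Lemma fat_ideal_primary p G F : homogeneous w p G ->
  (forall j, G.@[x j] != 0) -> G * F \in I -> F \in I.
Proof.
move=> Gp Gx /cap_idealP GF; apply/cap_idealP => j.
by apply: pow_point_ideal_primary Gp (Gx j) (GF j) => i.
Qed.

Lemma prod_lin_hom : homogeneous w (ones k) g.
Proof.
have -> : ones k = \sum_i unit_degree i.
  apply/ffunP=> l; rewrite ffunE.
  exact/esym/(sum_unit_degree (fun=> 1%N)).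
by apply: homogeneous_prod => i _.
Qed.

Lemma prod_lin_regular F : g * F \in I -> F \in I.
Proof.
apply: (fat_ideal_primary prod_lin_hom) => j.
by rewrite rmorph_prod; apply/prodf_neq0 => i _; apply: lin_x.
Qed.

Lemma prod_lin_regularX E F : g ^+ E * F \in I -> F \in I.
Proof.
elim: E => [|E IH]; first by rewrite mul1r.
by rewrite exprS -mulrA => /prod_lin_regular.
Qed.

(** With c_j = f(x_j) / L(x_j), the form f - c_j L vanishes at x_j, so that the
    product of the (f - c_j L)^m_j lies in I; modulo L it is a power of f. *)
Lemma power_mod_common_factor (f L : R) d :
    homogeneous w d f -> homogeneous w d L -> (forall j, L.@[x j] != 0) ->
  exists2 q, homogeneous w (d *+ total - d) q & f ^+ total - L * q \in I.
Proof.
move=> fd Ld Lx.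
(* good a F: F is f^a up to a multiple of L, homogeneously. *)
pose good a F := exists2 q, homogeneous w (d *+ a - d) q & F = f ^+ a - L * q.
have good1 : good 0%N 1.
  by exists 0; rewrite ?mulr0 ?subr0 //; apply: homogeneous0.
have goodM a b F G : good a F -> good b G -> good (a + b)%N (F * G).
  move=> [q qa ->] [q' q'b ->].
  exists (q * f ^+ b + f ^+ a * q' - L * q * q'); last by rewrite exprD; ring.
  have dE : d *+ (a + b) - d = d *+ a - d + d *+ b by rewrite mulrnDr addrAC.
  apply: homogeneousB; first apply: homogeneousD.
  - by rewrite dE; apply: homogeneousM => //; apply: homogeneous_exp.
  - by rewrite mulrnDr -addrA; apply: homogeneousM => //;
      apply: homogeneous_exp.
  rewrite dE (_ : _ + _ = d + (d *+ a - d) + (d *+ b - d)).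
    by do 2!apply: homogeneousM => //.
  by rewrite [d + _]addrC subrK addrA addrAC.
pose c j := f.@[x j] / L.@[x j].
have [q qd qE] : good total (\prod_j (f - c j *: L) ^+ m j).
  apply: (big_ind2 good) => // [a F b G|j _]; first exact: goodM.
  elim: (m j) => // e IH; rewrite exprS -add1n; apply: goodM => //.
  exists (c j)%:MP; first by rewrite mulr1n subrr; apply: homogeneousC.
  by rewrite expr1 mulrC mul_mpolyC.
exists q => //; rewrite -qE; apply: cap_pow_ideal_prod => j.
apply: gen_ideal_mem; split.
  by exists d; apply: homogeneousB => //; apply: homogeneousZ.
by rewrite mevalB mevalZ mulfVK ?subrr.
Qed.

(** When d is positive on each block, a product L of powers of the linear forms
    of degree d is a multiple of g. Thus inverting f on R / I inverts g. *)
Lemma power_mod_prod_lin (f : R) d : homogeneous w d f ->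
  (forall i, 1 <= d i) ->
  exists2 q, homogeneous w (d *+ total - ones k) q & f ^+ total - g * q \in I.
Proof.
move=> fd d1; have dE i : d i = (`|d i|.-1.+1)%:Z by have := d1 i; lia.
pose L' : R := \prod_i lin i ^+ `|d i|.-1.
have L'd : homogeneous w (d - ones k) L'.
  have -> : d - ones k = \sum_i unit_degree i *+ `|d i|.-1.
    apply/ffunP=> l; rewrite sum_unit_degree !ffunE {1}dE; lia.
  by apply: homogeneous_prod => i _; apply: homogeneous_exp.
have Ld : homogeneous w d (g * L').
  by rewrite -[d](subrK (ones k)) addrC; apply: homogeneousM => //;
    apply: prod_lin_hom.
have [j|q qd fq] := power_mod_common_factor fd Ld.
  rewrite mevalM !rmorph_prod mulf_neq0 //; apply/prodf_neq0 => i _;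
    first exact: lin_x.
  by rewrite rmorphXn expf_neq0 //; apply: lin_x.
exists (L' * q); last by rewrite mulrA.
have -> : d *+ total - ones k = (d - ones k) + (d *+ total - d).
  by rewrite [RHS]addrC [RHS]addrA subrK.
exact: homogeneousM.
Qed.

Lemma prod_lin_irrelevant : g \in irrelevant_ideal K w.
Proof.
apply/cap_idealP => l; rewrite (bigD1 l) // [X in X \in _]mulrC.
apply: idealM; apply: homogeneous_var_ideal (@lin_hom l) _.
by rewrite ffunE eqxx.
Qed.

Lemma irrelevant_degree p F : homogeneous w p F -> F \in irrelevant_ideal K w ->
  F != 0 -> forall i, 1 <= p i.
Proof.
move=> Fp /cap_idealP FB F0 i.
have /(var_ideal_msupp (FB i))[v wv mv] := mlead_supp F0.
rewrite -(Fp _ (mlead_supp F0)) ffunE lez_nat.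
by rewrite (bigD1 v) ?wv //= (leq_trans mv) // leq_addr.
Qed.

Lemma quot_gr0 p : quot_gr w (I := I) p 0.
Proof. by exists 0; [apply: homogeneous0 | rewrite raddf0]. Qed.

Lemma quot_grD p (y y' : M) : quot_gr w p y -> quot_gr w p y' ->
  quot_gr w p (y + y').
Proof.
move=> [F Fp ->] [G Gp ->]; exists (F + G); last by rewrite raddfD.
exact: homogeneousD.
Qed.

Lemma quot_grZ q p c (y : M) : homogeneous w q c -> quot_gr w p y ->
  quot_gr w (q + p) (c *: y).
Proof.
move=> cq [F Fp ->]; exists (c * F); last exact: scale_pi_ideal.
exact: homogeneousM.
Qed.

(** As H^1_B(M) = M_g / M, this expresses that H^1_B(M)_p = 0: the elements F /
    g^e of degree p of M_g come from M. *)
Definition divisible_in_degrees_above p := forall e F,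
  homogeneous w (p + ones k *+ e) F ->
  exists2 h, homogeneous w p h & F - g ^+ e * h \in I.

Section Family.
Variables (r : nat) (f : 'I_r -> R) (d : 'I_r -> degree k).
Hypothesis f_hom : forall j, homogeneous w (d j) (f j).
Hypothesis f_gen :
  irrelevant_ideal K w =i gen_ideal (fun F => exists j, F = f j).

Lemma prod_lin_in_powers n : exists E (c : 'I_r -> R),
  g ^+ E = \sum_l c l * f l ^+ n /\
  forall l, homogeneous w (ones k *+ E - d l *+ n) (c l).
Proof.
have := prod_lin_irrelevant; rewrite f_gen => /gen_family_coef[c gE].
pose J := gen_ideal (fun F => exists j, F = f j ^+ n).
have [l|E] := @radical_sum _ J _ c f n; first by apply: gen_ideal_mem; exists l.
rewrite -gE => /gen_family_coef[c' gE'].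
have f_hom' l : homogeneous w (d l *+ n) (f l ^+ n) by apply: homogeneous_exp.
exists E; apply: homogeneous_combination gE' => //.
by apply: homogeneous_exp; apply: prod_lin_hom.
Qed.

(** The successor in the exponent serves the case of a product f_t equal to 0,
    when the degrees d j, and so that of f_t, are arbitrary. *)
Lemma prod_lin_divides (t : {set 'I_r}) E n p y : t != set0 ->
  quot_gr w (I := I) (p + (\sum_(j in t) d j) *+ n + ones k *+ E) y ->
  exists y' : M, quot_gr w (p + (\sum_(j in t) d j) *+ (n + (total * E).+1)) y'
    /\ g ^+ E *: y' = famprod f t ^+ (total * E).+1 *: y.
Proof.
move=> /set0Pn[j0 j0t] [F Fhom ->].
have [->|ft0] := eqVneq (famprod f t) 0.
  by exists 0; rewrite expr0n scale0r scaler0; split=> //; apply: quot_gr0.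
have ft_hom : homogeneous w (\sum_(j in t) d j) (famprod f t).
  by apply: homogeneous_prod => j _.
have ftB : famprod f t \in irrelevant_ideal K w.
  rewrite f_gen /famprod (bigD1 j0) // [X in X \in _]mulrC.
  by apply: idealM; apply: gen_ideal_mem; exists j0.
have dt1 := irrelevant_degree ft_hom ftB ft0.
move: (\sum_(j in t) d j) ft_hom dt1 Fhom => dt ft_hom dt1 Fhom.
have [q q_hom /(congr_ideal_exp E) fq] := power_mod_prod_lin ft_hom dt1.
exists (\pi_M (famprod f t * (q ^+ E * F)))%qT; split.
  exists (famprod f t * (q ^+ E * F)) => //.
  have := homogeneousM (homogeneous_exp (e := E) q_hom) Fhom.
  move=> /(homogeneousM ft_hom); congr homogeneous.
  rewrite mulrnDr mulrS mulrnBl -mulrnA.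
  move: (dt *+ n) (dt *+ _) (ones k *+ E) => A B C.
  by apply/ffunP => l; rewrite !ffunE; ring.
rewrite !scale_pi_ideal; apply/eqP; rewrite -Quotient.idealrBE.
rewrite -opprB rpredN exprS -mulrA [X in X - _]mulrCA.
rewrite (_ : _ - _ = (famprod f t * F) *
   ((famprod f t ^+ total) ^+ E - (g * q) ^+ E)).
  exact: idealM.
by rewrite exprMn exprM; ring.
Qed.

(** The hypotheses of the contraction hold in every degree, except for the
    divisibility by g that the empty set of indices requires when i = 1. *)
Lemma fat_cech_exact i p : (i = 1%N -> divisible_in_degrees_above p) ->
  cech_exact (quot_gr w (I := I)) f d i p.
Proof.
move=> divp.
apply: (@cech_exact_of_regular _ _ _ (homogeneous w) _
  quot_gr0 quot_grD quot_grZ _ _ _ _ _ f_hom g (ones k)).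
- by move=> *; apply: homogeneous_exp.
- move=> e; rewrite -[0](mul0rn _ e); apply: homogeneous_exp.
  by rewrite -scaleN1r; apply: homogeneousZ; rewrite -mpolyC1;
    apply: homogeneousC.
- move=> y; rewrite -[y]reprK scale_pi_ideal => /pi_ideal_eq0 gy.
  exact/pi_ideal_eq0/prod_lin_regular.
- exact: prod_lin_in_powers.
move=> E; exists (total * E).+1 => t ti n y y_hom.
have [t0|] := eqVneq t set0; last by move/prod_lin_divides; apply.
move: ti y_hom; rewrite t0 cards0 /famprod !big_set0 !mul0rn !addr0 expr1n
  scale1r.
move=> /esym/divp + [F F_hom ->] => /(_ E F F_hom)[h h_hom Fh].
exists (\pi_M h)%qT; split; first by exists h.
rewrite scale_pi_ideal; apply/eqP; rewrite -Quotient.idealrBE -opprB.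
by rewrite rpredN.
Qed.
End Family.

Theorem fat_coh_zero i p : (i = 1%N -> divisible_in_degrees_above p) ->
  coh_zero w (quot_gr w (I := I)) i p.
Proof. by move=> divp r f d f_hom f_gen; apply: fat_cech_exact. Qed.

(** A power of g is a combination of high powers of the f j, and g is a
    nonzerodivisor modulo I: this is the vanishing of H^0_B(M). *)
Lemma locally_zero_mem r (f : 'I_r -> R) (d : 'I_r -> degree k) F :
    (forall j, homogeneous w (d j) (f j)) ->
    irrelevant_ideal K w =i gen_ideal (fun F => exists j, F = f j) ->
    (forall j, exists e, f j ^+ e * F \in I) ->
  F \in I.
Proof.
move=> f_hom f_gen /fin_all_exists[e eF].
have [E [c [gE _]]] := prod_lin_in_powers f_hom f_gen (\max_j e j).
apply: (@prod_lin_regularX E); rewrite gE mulr_suml; apply: rpred_sum => j _.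
by rewrite -(subnK (leq_bigmax j)) exprD -!mulrA; do 2!apply: idealM.
Qed.

(** The fraction F / g^e becomes F q_j^e / f_j^n over f_j <> 0, where 1 / g =
    q_j / f_j^total. These are the components of a 1-cocycle, and writing it as
    a coboundary gives h with F / g^e = h. *)
Lemma divisible_of_cech_exact r (f : 'I_r -> R) p :
    (forall j, homogeneous w (ones k) (f j)) ->
    irrelevant_ideal K w =i gen_ideal (fun F => exists j, F = f j) ->
    cech_exact (quot_gr w (I := I)) f (fun=> ones k) 1 p ->
  divisible_in_degrees_above p.
Proof.
move=> f_hom f_gen H1 e F F_hom.
have fq j : exists q, homogeneous w (ones k *+ total - ones k) q /\
    f j ^+ total - g * q \in I.
  have [|q] := power_mod_prod_lin (f_hom j); last by exists q.
  by move=> i; rewrite ffunE.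
have /fin_all_exists[q qP] := fq.
pose n := (total * e)%N.
pose a (t : {set 'I_r}) : M :=
  if [pick j in t] is Some j then (\pi_M (F * q j ^+ e))%qT else 0.
have a1 j : a [set j] = (\pi_M (F * q j ^+ e))%qT.
  by rewrite /a; case: pickP => [l|/(_ j)]; rewrite inE ?eqxx // => /eqP ->.
have ga j : g ^+ e *: a [set j] = f j ^+ n *: (\pi_M F)%qT.
  rewrite a1 !scale_pi_ideal; apply/eqP; rewrite -Quotient.idealrBE.
  rewrite -opprB rpredN.
  rewrite (_ : _ - _ = F * ((f j ^+ total) ^+ e - (g * q j) ^+ e)).
    by apply/idealM/congr_ideal_exp; case: (qP j).
  by rewrite exprMn -exprM; ring.
have regular (y : M) : g ^+ e *: y = 0 -> y = 0.
  rewrite -[y]reprK scale_pi_ideal => /pi_ideal_eq0/prod_lin_regularX.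
  by move/pi_ideal_eq0.
have [t|t|m' [b [b_hom b_eq]]] := H1 n a.
- move=> /eqP/cards1P[j ->]; rewrite /cech_homog a1 big_set1;
    exists (F * q j ^+ e) => //.
  have [q_hom _] := qP j.
  have := homogeneousM F_hom (homogeneous_exp (e := e) q_hom).
  congr homogeneous; rewrite mulrnBl -mulrnA -/n.
  by rewrite -addrA [_ *+ e + _]addrC subrK.
- move=> /eqP/cards2P[j [l [jl ->]]]; exists 0%N; rewrite expr0 scale1r;
    apply: regular.
  have jl' : l \notin [set j] by rewrite inE eq_sym.
  rewrite setUC /cech_diff big_setU1 //= big_set1 setU1K // scalerDr.
  have -> : (l |: [set j]) :\ j = [set l].
    by rewrite setUC setU1K // inE.
  have swap (c c' : R) (y : M) :
      g ^+ e *: (c *: (c' *: y)) = (c * c') *: (g ^+ e *: y).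
    by rewrite !scalerA; congr (_ *: _); ring.
  rewrite !swap !ga !scalerA -scalerDl !card_below_setU1 //
    !card_below_set1 !ltnn.
  rewrite [X in X *: _](_ : _ = 0) ?scale0r //.
  have : j != l := jl; rewrite -val_eqE.
  by case: (ltngtP j l) => // _ _; rewrite /= ?expr0 ?expr1; ring.
have [|h h_hom bE] := b_hom set0; first by rewrite cards0.
exists h; first by move: h_hom; rewrite big_set0 mul0rn addr0.
apply: (locally_zero_mem f_hom f_gen) => j.
have [|e' e'P] := b_eq [set j]; first by rewrite cards1.
exists (e' + m' + n)%N; apply/pi_ideal_eq0; rewrite -scale_pi_ideal.
move: e'P => /(congr1 ( *:%R (g ^+ e))); rewrite scaler0 => <-.
rewrite /famprod !big_set1 /cech_diff big_set1 setDv bE.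
rewrite card_below_set1 ltnn expr0 scale1r scalerBr scalerBr !scalerA.
rewrite [_ *: a _](_ : _ = (f j ^+ e' * f j ^+ m') *: (g ^+ e *: a [set j]));
  last first.
  by rewrite scalerA; congr (_ *: _); ring.
rewrite ga raddfB /= scalerBr scalerA; congr (_ - _).
  by congr (_ *: _); rewrite -!exprD.
rewrite -scale_pi_ideal scalerA; congr (_ *: _); rewrite !exprD; ring.
Qed.

Theorem divisible_of_coh_zero p :
  coh_zero w (quot_gr w (I := I)) 1 p -> divisible_in_degrees_above p.
Proof.
move=> H1; have [f_hom f_gen] := irrelevant_ideal_gens K w.
exact: divisible_of_cech_exact f_hom f_gen (H1 _ _ _ f_hom f_gen).
Qed.
End FatPoints.

(** * Blocks of variables *)

Section Blocks.
Variables (K : fieldType) (k : nat) (n : 'I_k -> nat).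
Local Notation R := {mpoly K[num_vars n]}.
Local Notation Rb i := {mpoly K[(n i).+1]}.

Definition block_var i (j : 'I_(n i).+1) : 'I_(num_vars n) :=
  enum_rank (Tagged (fun i => 'I_(n i).+1) j).

Lemma block_block_var i j : block (@block_var i j) = i.
Proof. by rewrite /block enum_rankK. Qed.

Lemma coords_block_var (P : multi_vec K n) i j :
  coords P (@block_var i j) = P i 0 j.
Proof. by rewrite /coords enum_rankK. Qed.

(** The inclusion of the coordinate ring of the i-th factor. *)
Definition embed i : Rb i -> R :=
  mmap (@mpolyC _ K) (fun j => 'X_(block_var j)).
HB.instance Definition _ i := GRing.RMorphism.copy (@embed i) (@embed i).

Lemma embedX i mu : embed ('X_[mu] : Rb i) = \prod_j 'X_(block_var j) ^+ mu j.
Proof. by rewrite /embed mmapX. Qed.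

Lemma embedZ i c (F : Rb i) : embed (c *: F) = c *: embed F.
Proof. by rewrite /embed mmapZ mul_mpolyC. Qed.

Definition block_degree i (z : int) : degree k :=
  [ffun l => if l == i then z else 0].

Lemma homogeneous_embed i p (F : Rb i) : homogeneous std_grading p F ->
  homogeneous (@block k n) (block_degree i (p ord0)) (embed F).
Proof.
move=> Fp; rewrite [F]mpolyE big_seq rmorph_sum /=.
apply: homogeneous_sum => mu /Fp <-; rewrite embedZ; apply: homogeneousZ.
rewrite embedX.
have -> : block_degree i (mon_degree std_grading mu ord0)
    = \sum_j unit_degree i *+ mu j.
  apply/ffunP => l; rewrite sum_ffunE !ffunE.
  under [RHS]eq_bigr do rewrite ffunMnE ffunE.
  case: (l == i); last by rewrite big1 // => j _; rewrite mul0rn.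
  rewrite (eq_bigl predT) // -natz natr_sum.
  by apply: eq_bigr.
apply: homogeneous_prod => j _; apply: homogeneous_exp.
by rewrite -{1}(block_block_var j); apply: homogeneousU.
Qed.

Lemma embed_eval i (F : Rb i) (P : multi_vec K n) :
  (embed F).@[coords P] = F.@[P i 0].
Proof.
rewrite /embed /mmap raddf_sum mevalE; apply: eq_bigr => mu _ /=.
rewrite mevalM mevalC /mmap1 rmorph_prod /=; congr (_ * _).
by apply: eq_bigr => j _; rewrite rmorphXn /= mevalXU coords_block_var.
Qed.

Lemma embed_point_ideal i (P : multi_vec K n) (F : Rb i) :
  F \in point_ideal std_grading (P i 0) ->
  embed F \in point_ideal (@block k n) (coords P).
Proof.
move=> /asboolP[r [a [t [St ->]]]]; rewrite rmorph_sum; apply: rpred_sum => l _.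
rewrite rmorphM; apply: idealM; apply: gen_ideal_mem.
have [[p tp] tP] := St l; split; last by rewrite embed_eval.
by exists (block_degree i (p ord0)); apply: homogeneous_embed.
Qed.

Lemma mpolyX_blocks (mu : 'X_{1..num_vars n}) : 'X_[mu] =
  \prod_i embed ('X_[ [multinom mu (block_var j) | j < (n i).+1] ] : Rb i) :> R.
Proof.
under [RHS]eq_bigr do rewrite embedX.
rewrite mpolyXE_id (reindex_onto (@enum_rank (multi_var n)) enum_val) /=;
  last first.
  by move=> v _; rewrite enum_valK.
rewrite (eq_bigl predT) => [|u]; last by rewrite enum_rankK eqxx.
rewrite sig_big_dep /=; apply: eq_big => // -[i j] _ /=.
by rewrite mnmE.
Qed.

Lemma sum_block_degree (c : 'I_k -> int) :
  \sum_i block_degree i (c i) = [ffun i => c i].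
Proof.
apply/ffunP => l; rewrite sum_ffunE !ffunE (bigD1 l) //= ffunE eqxx.
by rewrite big1 ?addr0 // => i /negPf il; rewrite ffunE eq_sym il.
Qed.

(** The degree of the monomial is read off its factorization into blocks. *)
Lemma mon_degree_blocks (mu : 'X_{1..num_vars n}) i :
  mon_degree std_grading [multinom mu (block_var j) | j < (n i).+1] ord0
  = mon_degree (@block k n) mu i.
Proof.
have : homogeneous (@block k n) (\sum_i block_degree i
   (mon_degree std_grading [multinom mu (block_var j) | j < (n i).+1] ord0))
   ('X_[mu] : R).
  rewrite mpolyX_blocks; apply: homogeneous_prod => l _.
  by apply: homogeneous_embed; apply: homogeneousX.
by move=> /(_ mu); rewrite msuppX inE => -> //;
  rewrite sum_block_degree [RHS]ffunE.
Qed.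

Variables (s : nat) (P : 'I_s -> multi_vec K n) (m : 'I_s -> nat).

Lemma embed_ideal_proj i (F : Rb i) :
  F \in ideal_proj P m i -> embed F \in ideal_Z P m.
Proof.
move=> /cap_idealP FI; apply/cap_idealP => j.
apply: pow_ideal_rmorph (FI j) => G; exact: embed_point_ideal.
Qed.

Variable lin : forall i, Rb i.

(** A monomial of degree p + e (1, ..., 1) is a product over i of monomials of
    degree p_i + e in the i-th block; each is congruent to lin_i^e h_i modulo
    the ideal of Z_i, which is contained in that of Z, and these congruences
    multiply. *)
Lemma divisible_of_projections (p : degree k) :
    (forall i, divisible_in_degrees_above std_grading (fun j => P j i 0) m
                 (fun=> lin i) [ffun=> p i]) ->
  divisible_in_degrees_above (@block k n) (fun j => coords (P j)) m
    (fun i => embed (lin i)) p.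
Proof.
move=> div e F F_hom; set g := \prod_i _.
rewrite [F]mpolyE big_seq.
apply: (big_ind (fun G => exists2 h, homogeneous (@block k n) p h &
  G - g ^+ e * h \in ideal_Z P m)).
- exists 0; first exact: homogeneous0.
  by rewrite mulr0 subr0 rpred0.
- move=> G G' [h h_hom Gh] [h' h'_hom Gh']; exists (h + h').
    exact: homogeneousD.
  by rewrite mulrDr opprD addrACA rpredD.
move=> mu /F_hom muE.
pose mu_ i : 'X_{1..(n i).+1} := [multinom mu (block_var j) | j < (n i).+1].
have dec i : exists h : Rb i, homogeneous std_grading [ffun=> p i] h /\
    'X_[mu_ i] - lin i ^+ e * h \in ideal_proj P m i.
  have [|h h_hom Xh] := div i e 'X_[mu_ i].
    suff <- : mon_degree std_grading (mu_ i) = [ffun=> p i] + ones 1 *+ e.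
      exact: homogeneousX.
    apply/ffunP => l; rewrite (ord1 l) mon_degree_blocks muE.
    rewrite !ffunE ffunMnE ffunE.
    by rewrite ffunMnE ffunE.
  by exists h; split; [exact: h_hom | move: Xh; rewrite big_ord1].
have [h hP] := fin_all_exists dec.
exists (F@_mu *: \prod_i embed (h i)).
  apply: homogeneousZ.
  have -> : p = \sum_i block_degree i (p i).
    by rewrite sum_block_degree; apply/ffunP => i; rewrite ffunE.
  apply: homogeneous_prod => i _; have [h_hom _] := hP i.
  by have := homogeneous_embed h_hom; rewrite ffunE.
rewrite -scalerAr -scalerBr -mul_mpolyC; apply: idealM.
rewrite mpolyX_blocks /g -prodrXl -big_split; apply: congr_ideal_prod => i.
have [_ /embed_ideal_proj] := hP i.
by rewrite rmorphB rmorphM rmorphXn.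
Qed.
End Blocks.

(** * The regularity bound *)

(** The forms sum_i t^i X_i suffice: each v_j excludes only the roots t of a
    nonzero polynomial, and an algebraically closed field is infinite. *)
Lemma exists_nonvanishing_form (K : closedFieldType) (d s : nat)
    (v : 'I_s -> 'rV[K]_d.+1) : (forall j, v j != 0) ->
  exists a : 'I_d.+1 -> K, forall j, \sum_i a i * v j 0 i != 0.
Proof.
move=> v0; pose p j := \poly_(i < d.+1) v j 0 (inord i).
have p0 j : p j != 0.
  apply: contra_neq (v0 j) => pj0; apply/rowP => i; rewrite mxE.
  by have := coef_poly d.+1 (fun i => v j 0 (inord i)) i;
    rewrite -/(p j) pj0 coef0 ltn_ord inord_val.
have /closed_nonrootP[t] : \prod_j p j != 0 by apply/prodf_neq0 => j _.
rewrite /root horner_prod => /prodf_neq0 pt.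
exists (fun i => t ^+ i) => j; have := pt j isT; rewrite horner_poly.
by congr (_ != 0); apply: eq_bigr => i _; rewrite inord_val mulrC.
Qed.

Theorem proposition4p4 (K : closedFieldType) (hK : [pchar K] =i pred0)
    (k : nat) (hk : (0 < k)%N) (n : 'I_k -> nat) (hn : forall i, (0 < n i)%N)
    (s : nat) (hs : (0 < s)%N)
    (P : 'I_s -> multi_vec K n) (hP : forall j, is_point (P j))
    (P_distinct : forall j l, same_point (P j) (P l) -> j = l)
    (m : 'I_s -> nat) (hm : forall j, (0 < m j)%N)
    (r : 'I_k -> int) (hr : forall i, is_reg_proj P m i (r i)) :
  forall u : 'I_k -> nat,
    in_regB_Z P m [ffun i => r i + (u i)%:Z].
Proof.
have /fin_all_exists[a a_neq0] :=
  fun i => exists_nonvanishing_form (fun j => hP j i).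
pose lin i : {mpoly K[(n i).+1]} := \sum_j a i j *: 'X_j.
have lin_hom i (l : 'I_1) : homogeneous std_grading (unit_degree l) (lin i).
  apply: homogeneous_sum => j _; apply: homogeneousZ.
  by rewrite (ord1 l); apply: homogeneousU.
have lin_P i j : (lin i).@[P j i 0] != 0.
  rewrite raddf_sum /=; have := a_neq0 i j; congr (_ != 0).
  by apply: eq_bigr => v _; rewrite mevalZ mevalXU.
(* A nonzero H^1 in degree z bounds the regularity below by z + 1. *)
have divisible i (z : int) : r i <= z -> divisible_in_degrees_above std_grading
    (fun j => P j i 0) m (fun=> lin i) [ffun=> z].
  move=> rz; apply: divisible_of_coh_zero => [l|_ j|];
    [exact: lin_hom|exact: lin_P|].
  apply: contrapT => nonzero; have [_ /(_ 1%N z nonzero)] := hr i.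
  by lia.
move=> u c p [q [v [_ pE]]].
apply: (@fat_coh_zero _ _ _ _ _ _ _ (fun i => embed (lin i))) => [i|i j|c1].
- have -> : unit_degree i = block_degree i (unit_degree (ord0 : 'I_1) ord0).
    by apply/ffunP => l; rewrite !ffunE eqxx; case: eqP.
  exact/homogeneous_embed/lin_hom.
- by rewrite embed_eval.
(* N^k[0] = N^k: the degree p is at least r in each coordinate. *)
apply: divisible_of_projections => i; apply: divisible.
have := pE i; rewrite c1 subrr sgz0 mul0r add0r !ffunE.
by move: (p i) (r i) (u i) (v i) => ? ? ? ?; lia.
Qed.
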